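(* For every integer $k$, there are only finitely many connected graphs with maximum valency at most $k$ that are Laplacian periodic at some vertex.
   Context: For a graph with Laplacian $L=D-A$ ($D$ the diagonal degree matrix, $A$ the adjacency matrix) and $U(t)=\exp(itL)$, the graph is Laplacian periodic at vertex $a$ if $U(\tau)e_a=\alpha e_a$ for some time $\tau>0$ and some complex $\alpha$. *)

(* Defs.v *)
From mathcomp Require Import all_boot all_order all_algebra.
From mathcomp Require Import all_classical all_reals all_analysis.
From mathcomp Require Import complex.

Set Implicit Arguments.
Unset Strict Implicit.
Unset Printing Implicit Defensive.

Import Order.TTheory GRing.Theory Num.Theory.
Import numFieldNormedType.Exports.
Local Open Scope classical_set_scope.
Local Open Scope ring_scope.
Local Open Scope complex_scope.

Record sgraph := SGraph {
  svertex :> finType;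
  adj : rel svertex;
  adj_sym : symmetric adj;
  adj_irrefl : irreflexive adj }.

Definition sgraph_iso (G H : sgraph) : Prop :=
  exists f : G -> H, bijective f /\ forall x y, adj (f x) (f y) = adj x y.

Definition valency (G : sgraph) (x : G) : nat := #|[pred y | adj x y]|.

Definition max_valency (G : sgraph) : nat := \max_(x : G) valency x.

Definition connected_graph (G : sgraph) : Prop :=
  forall x y : G, connect (@adj G) x y.

(* Rows and columns are indexed by the vertices through the enumeration
   [enum_val : 'I_#|G| -> G], with inverse [enum_rank]. *)
Definition adj_mx (K : pzRingType) (G : sgraph) : 'M[K]_#|G| :=
  \matrix_(i, j) (adj (enum_val i) (enum_val j))%:R.

Definition degree_mx (K : pzRingType) (G : sgraph) : 'M[K]_#|G| :=
  diag_mx (\row_i (valency (enum_val i))%:R).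

Definition laplacian (K : pzRingType) (G : sgraph) : 'M[K]_#|G| :=
  degree_mx K G - adj_mx K G.

Definition vertex_vec (K : pzRingType) (G : sgraph) (a : G) : 'cV[K]_#|G| :=
  delta_mx (enum_rank a) 0.

Definition mxexp (K : numFieldType) (n : nat) (M : 'M[K]_n) : 'M[K]_n :=
  lim (series (fun k => k`!%:R^-1 *: M ^+ k) @ \oo).

Definition transition_mx (R : realType) (G : sgraph) (t : R) : 'M[R[i]]_#|G| :=
  mxexp (('i * t%:C) *: laplacian R[i] G).

Definition laplacian_periodic (R : realType) (G : sgraph) (a : G) : Prop :=
  exists tau : R, 0 < tau /\
    exists alpha : R[i],
      transition_mx G tau *m vertex_vec R[i] a = alpha *: vertex_vec R[i] a.

Definition finitely_many_up_to_iso (P : sgraph -> Prop) : Prop :=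
  exists (N : nat) (s : 'I_N -> sgraph),
    forall G : sgraph, P G -> exists i : 'I_N, sgraph_iso G (s i).

(* Main.v *)
(* Write L = P^-1 D P with D real diagonal, so that U(t) = P^-1 exp(itD) P. If U(tau) e_a is a
   multiple of e_a, the multiple is 1 because the all-ones vector is fixed by U(tau); hence every
   eigenvalue in the support of a lies in (2 pi / tau) N. The monic polynomial whose simple roots
   are the support eigenvalues is the minimal polynomial of e_a with respect to the integer
   matrix L, so it is rational. Its roots are nonnegative integer multiples of one real number and
   their sum is rational, so all of them are rational, hence integers. By Gershgorin they lie in
   [0, 2k], so there are at most 2k+1 of them and e_a is annihilated by a monic polynomial in L of
   degree d <= 2k+1. Then no vertex is at distance d from a, so the ball of radius 2k around a
   contains all vertices, which bounds the order of the graph. *)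
Require Import Defs.
From mathcomp Require Import all_boot all_order all_algebra all_field.
From mathcomp Require Import all_classical all_reals all_analysis.
From mathcomp Require Import complex ring lra.

Set Implicit Arguments.
Unset Strict Implicit.
Unset Printing Implicit Defensive.

Import Order.TTheory GRing.Theory Num.Theory.
Import numFieldNormedType.Exports.
Local Open Scope classical_set_scope.
Local Open Scope ring_scope.
Local Open Scope complex_scope.

(** * Exponential of a diagonalizable matrix and the period of the cosine *)

Lemma cvg_mx_coord (T : ptopologicalType) (m n : nat) (f : nat -> 'M[T]_(m, n))
    (M : 'M[T]_(m, n)) :
  (forall i j, f k i j @[k --> \oo] --> M i j) -> f @ \oo --> M.
Proof.
move=> cvg_f A [B nbhsB subA].
have near_B : \forall k \near \oo, forall i j, B i j (f k i j).
  apply: filter_forall => i; apply: filter_forall => j.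
  exact: cvg_f (nbhsB i j).
by apply: filterS near_B => k; apply: subA.
Qed.

Lemma continuous_real_complex (R : realType) :
  continuous (real_complex R : R -> (R[i] : numFieldType)).
Proof.
move=> x A /nbhs_ballP[e e0 subA]; apply/nbhs_ballP.
(* A positive element of [R[i]] has zero imaginary part, so its real part serves as the radius in
   [R]. *)
move: e0; rewrite /= ltcE /= => /andP[/eqP e_real e0].
exists (complex.Re e) => // y; rewrite -!ball_normE /= => xy; apply: subA.
rewrite -ball_normE /= -rmorphB normc_def /= expr0n addr0 sqrtr_sqr ltcE /=.
by rewrite -e_real eqxx.
Qed.

(** Euler's formula term by term: the parity of [k] decides whether the term belongs to the cosine
    or to the sine series. *)
Lemma exp_coeff_cos_sin (R : realType) (x : R) (k : nat) :
  k`!%:R^-1 * ('i * x%:C) ^+ k =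
  (cos_coeff x k)%:C + 'i * (sin_coeff x k)%:C.
Proof.
have i_exp : 'i ^+ k = ((~~ odd k)%:R * (-1) ^+ k./2)%:C +
    'i * ((odd k)%:R * (-1) ^+ k.-1./2)%:C :> R[i].
  rewrite -{1}(odd_double_half k) -muln2 mulnC exprD exprM sqr_i.
  have [k_odd|k_even] := boolP (odd k) => /=; last first.
    by rewrite mul0r rmorph0 mulr0 addr0 !mul1r rmorphXn rmorphN1.
  rewrite mul0r rmorph0 add0r mul1r rmorphXn rmorphN1 expr1.
  by rewrite -{2}(odd_double_half k) k_odd add1n /= doubleK.
rewrite exprMn i_exp -(rmorph_nat (real_complex R)) -fmorphV -rmorphXn.
rewrite /cos_coeff /sin_coeff /= -exprnP !rmorphM /=.
ring.
Qed.

Lemma cvg_exp_i (R : realType) (x : R) :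
  series (fun k => k`!%:R^-1 * ('i * x%:C) ^+ k : (R[i] : numFieldType)) @ \oo -->
  ((cos x)%:C + 'i * (sin x)%:C : (R[i] : numFieldType)).
Proof.
have cvg_cos : series (cos_coeff x) @ \oo --> cos x.
  by rewrite unlock; apply: is_cvg_series_cos_coeff.
have cvg_sin : series (sin_coeff x) @ \oo --> sin x.
  by rewrite unlock; apply: is_cvg_series_sin_coeff.
have -> : series (fun k => k`!%:R^-1 * ('i * x%:C) ^+ k : (R[i] : numFieldType)) =
    fun n => (series (cos_coeff x) n)%:C + 'i * (series (sin_coeff x) n)%:C.
  apply/funext => n; rewrite /series /= !rmorph_sum mulr_sumr -big_split.
  by apply: eq_bigr => k _; apply: exp_coeff_cos_sin.
apply: cvgD; last apply: cvgMl_tmp.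
  by apply: (cvg_comp _ _ cvg_cos); apply: continuous_real_complex.
by apply: (cvg_comp _ _ cvg_sin); apply: continuous_real_complex.
Qed.

Lemma conj_diagX (K : fieldType) (n : nat) (P : 'M[K]_n) (d : 'rV[K]_n) (k : nat) :
  P \in unitmx ->
  (invmx P *m diag_mx d *m P) ^+ k =
  invmx P *m diag_mx (\row_j d 0 j ^+ k) *m P.
Proof.
move=> P_unit; elim: k => [|k IHk].
  rewrite expr0 (_ : \row_j _ = const_mx 1) ?diag_const_mx ?mulmx1 ?mulVmx //.
  by apply/rowP => j; rewrite !mxE.
rewrite exprSr IHk -[_ * _]/(_ *m _) !mulmxA mulmxK //.
by congr (_ *m _); rewrite -!mulmxA mulmx_diag; congr (_ *m diag_mx _);
  apply/rowP => j; rewrite !mxE exprSr.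
Qed.

(** Powers of the conjugate act on the diagonal only, so each entry of a partial sum is a fixed
    linear combination of the scalar partial sums. *)
Lemma mxexp_conj_diag (K : numFieldType) (n : nat) (P : 'M[K]_n) (z e : 'rV[K]_n) :
  P \in unitmx ->
  (forall j, series (fun k => k`!%:R^-1 * z 0 j ^+ k) @ \oo --> e 0 j) ->
  mxexp (invmx P *m diag_mx z *m P) = invmx P *m diag_mx e *m P.
Proof.
move=> P_unit cvg_e; set M := invmx P *m _ *m _; set E := RHS.
have cvg_ij i j :
    series (fun k => k`!%:R^-1 *: M ^+ k) N i j @[N --> \oo] --> E i j.
  have entry (d : 'rV[K]_n) : (invmx P *m diag_mx d *m P) i j =
      \sum_l invmx P i l * P l j * d 0 l.
    by rewrite !mxE; apply: eq_bigr => l _; rewrite mul_mx_diag mxE mulrAC.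
  have term k : (k`!%:R^-1 *: M ^+ k) i j =
      \sum_l k`!%:R^-1 * (invmx P i l * P l j * z 0 l ^+ k).
    rewrite mxE conj_diagX // entry mulr_sumr.
    by apply: eq_bigr => l _; rewrite mxE.
  rewrite /E entry.
  have -> : (fun N => series (fun k => k`!%:R^-1 *: M ^+ k) N i j) =
    fun N => \sum_l invmx P i l * P l j *
       series (fun k => k`!%:R^-1 * z 0 l ^+ k) N.
    apply/funext => N; rewrite /series /= summxE.
    rewrite (eq_bigr _ (fun k _ => term k)).
    rewrite exchange_big; apply: eq_bigr => l _; rewrite mulr_sumr.
    by apply: eq_bigr => k _; rewrite mulrCA.
  apply: cvg_big => [|l _]; first exact: add_continuous.
  exact: cvgMl_tmp.
have cvg_M := cvg_mx_coord cvg_ij.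
(* The limit in [mxexp] is identified entry by entry, by uniqueness of limits in [K]. *)
have cvg_lim : series (fun k => k`!%:R^-1 *: M ^+ k) @ \oo --> mxexp M.
  by apply: cvgP cvg_M.
apply/matrixP => i j.
have cvg_lim_ij : series (fun k => k`!%:R^-1 *: M ^+ k) N i j @[N --> \oo] --> mxexp M i j.
  exact: cvg_comp _ _ cvg_lim (@coord_continuous K n n i j (mxexp M)).
apply: (cvg_unique _ cvg_lim_ij (cvg_ij i j)).
exact: norm_hausdorff.
Qed.

(** Removing whole periods leaves [y] in [0, 2 pi) with sin (y / 2) = 0, and the sine is positive on
    (0, pi). *)
Lemma cos_eq1 (R : realType) (x : R) :
  0 <= x -> cos x = 1 -> exists m : nat, x = m%:R * (pi *+ 2).
Proof.
move=> x_ge0 cosx1.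
have pi2_gt0 : 0 < pi *+ 2 :> R by rewrite mulrn_wgt0 // pi_gt0.
pose m := Num.truncn (x / (pi *+ 2)); exists m.
have /truncn_itv/andP[] : 0 <= x / (pi *+ 2) by rewrite divr_ge0 // ltW.
rewrite -/m ler_pdivlMr // ltr_pdivrMr // => m_le lt_m.
pose y := x - m%:R * (pi *+ 2).
have y_ge0 : 0 <= y by rewrite subr_ge0.
have y_lt : y < pi *+ 2.
  by rewrite ltrBlDl; move: lt_m; rewrite -natr1 mulrDl mul1r.
have cosy1 : cos y = 1.
  have := periodicn (@cosD2pi R) m y.
  by rewrite -[_ *+ m]mulr_natl subrK cosx1.
have /eqP : sin (y / 2) ^+ 2 = 0.
  have := cosy1; rewrite {1}(splitr y) -mulr2n cos_mulr2n cos2sin2 => h.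
  by apply: (@mulrI _ 2); rewrite ?unitfE ?pnatr_eq0 // mulr0; lra.
rewrite sqrf_eq0 => /eqP sin0.
have [y0|y_gt0] := leP y 0.
  by apply/eqP; rewrite -subr_eq0 eq_le y0 y_ge0.
have : 0 < sin (y / 2).
  by apply: sin_gt0_pi; rewrite divr_gt0 //= ltr_pdivrMr // mulr_natr.
by rewrite sin0 ltxx.
Qed.

(** * Spectral decomposition and the minimal polynomial of a vector *)

(** The spectral theorem for Hermitian matrices, with the eigenvalues kept in [R] so that the cosine
    and the order apply to them. *)
Lemma symmetric_diagonalizable (R : realType) (n : nat) (A : 'M[R]_n) :
  A^T = A ->
  exists2 P : 'M[R[i]]_n, P \in unitmx & exists t : 'rV[R]_n,
    map_mx (real_complex R) A =
    invmx P *m diag_mx (map_mx (real_complex R) t) *m P.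
Proof.
move=> A_sym; pose M := map_mx (real_complex R) A.
have M_real : M \is a mxOver Num.real.
  by apply/mxOverP => i j; rewrite mxE complex_real.
have M_herm : M \is hermsymmx.
  apply: realsym_hermsym => //; apply/is_hermitianmxP.
  by rewrite expr0 scale1r map_mx_id // map_trmx A_sym.
exists (spectralmx M); first exact: spectral_unit.
exists (map_mx (@complex.Re R) (spectral_diag M)).
rewrite -map_mx_comp map_mx_id_in; last first.
  move=> i j; apply: RRe_real.
  by have /mxOverP := hermitian_spectral_diag_real M_herm.
exact/orthomx_spectralP/hermitian_normalmx.
Qed.

Lemma diag_mx_expr_vec (K : fieldType) (n : nat) (P : 'M[K]_n) (d : 'rV[K]_n)
    (v : 'cV[K]_n) (k : nat) (j : 'I_n) : P \in unitmx ->
  (P *m ((invmx P *m diag_mx d *m P) ^+ k *m v)) j 0 =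
  d 0 j ^+ k * (P *m v) j 0.
Proof.
move=> P_unit; rewrite conj_diagX // !mulmxA mulmxV // mul1mx.
by rewrite -mulmxA mul_diag_mx mxE mxE.
Qed.

(** The vector p(A) v. *)
Definition horner_vec (K : nzRingType) (n : nat) (A : 'M[K]_n) (v : 'cV[K]_n)
    (p : {poly K}) : 'cV[K]_n :=
  \sum_(i < size p) p`_i *: (A ^+ i *m v).

Lemma horner_vec_diag (K : fieldType) (n : nat) (P : 'M[K]_n) (d : 'rV[K]_n)
    (v : 'cV[K]_n) (p : {poly K}) (j : 'I_n) : P \in unitmx ->
  (P *m horner_vec (invmx P *m diag_mx d *m P) v p) j 0 =
  p.[d 0 j] * (P *m v) j 0.
Proof.
move=> P_unit; rewrite /horner_vec mulmx_sumr summxE horner_coef mulr_suml.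
by apply: eq_bigr => i _; rewrite -scalemxAr mxE diag_mx_expr_vec // mulrA.
Qed.

(** With [w] the coordinates of a vector in an eigenbasis, this is its eigenvalue support; [undup]
    makes the roots of [support_poly] simple. *)
Definition support_seq (K : fieldType) (n : nat) (d : 'rV[K]_n) (w : 'cV[K]_n) :
    seq K := undup [seq d 0 j | j <- enum 'I_n & w j 0 != 0].

Lemma support_seqP (K : fieldType) (n : nat) (d : 'rV[K]_n) (w : 'cV[K]_n) (z : K) :
  reflect (exists2 j, w j 0 != 0 & z = d 0 j) (z \in support_seq d w).
Proof.
rewrite mem_undup; apply: (iffP mapP) => [[j]|[j wj ->]].
  by rewrite mem_filter => /andP[wj _] ->; exists j.
by exists j => //; rewrite mem_filter wj mem_enum.
Qed.

Definition support_poly (K : fieldType) (n : nat) (d : 'rV[K]_n) (w : 'cV[K]_n) :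
  {poly K} := \prod_(z <- support_seq d w) ('X - z%:P).

Lemma support_poly_vec (K : fieldType) (n : nat) (P : 'M[K]_n) (d : 'rV[K]_n)
    (v : 'cV[K]_n) : P \in unitmx ->
  horner_vec (invmx P *m diag_mx d *m P) v (support_poly d (P *m v)) = 0.
Proof.
move=> P_unit; set x := horner_vec _ _ _.
suff Px0 : P *m x = 0 by rewrite -[x](mulKmx P_unit) Px0 mulmx0.
apply/colP => j; rewrite horner_vec_diag // [RHS]mxE.
have [->|wj] := eqVneq ((P *m v) j 0) 0; first by rewrite mulr0.
suff /eqP-> : root (support_poly d (P *m v)) (d 0 j) by rewrite mul0r.
by rewrite root_prod_XsubC; apply/support_seqP; exists j.
Qed.

(** Linear dependence does not change under field extension: [A ^+ size s *m v] is a combination of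
    the lower powers applied to [v] already over [F], and the coefficients form the required
    polynomial. *)
Lemma support_poly_descent (F K : fieldType) (f : {rmorphism F -> K}) (n : nat)
    (A : 'M[F]_n) (v : 'cV[F]_n) (P : 'M[K]_n) (d : 'rV[K]_n) :
  P \in unitmx -> map_mx f A = invmx P *m diag_mx d *m P ->
  exists g : {poly F}, map_poly f g = support_poly d (P *m map_mx f v).
Proof.
move=> P_unit A_diag; set w := P *m _; set p := support_poly d w.
pose s := support_seq d w.
have size_p : size p = (size s).+1 by rewrite size_prod_XsubC.
have lead_p : p`_(size s) = 1.
  by have /monicP := monic_prod_XsubC s xpredT id; rewrite lead_coefE size_p.
pose B := \matrix_(i < size s) (A ^+ i *m v)^T.
have fAX i : map_mx f (A ^+ i *m v) = (invmx P *m diag_mx d *m P) ^+ i *m map_mx f v.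
  rewrite map_mxM -A_diag; congr (_ *m _).
  by elim: i => [|i IH]; rewrite ?expr0 ?map_mx1 // !exprS -!mulmxE map_mxM IH.
(* Membership in the row space may be tested over [K], where [support_poly] gives the relation. *)
have /submxP[c vB] : ((A ^+ (size s) *m v)^T <= B)%MS.
  rewrite -(map_submx f) -map_trmx fAX.
  have := support_poly_vec d (map_mx f v) P_unit; rewrite -/w -/p /horner_vec size_p.
  rewrite big_ord_recr /= lead_p scale1r addrC => /eqP; rewrite addr_eq0 => /eqP->.
  rewrite linearN linear_sum eqmx_opp; apply: summx_sub => i _.
  rewrite linearZ scalemx_sub //; apply: (eq_row_sub i).
  by rewrite -map_row rowK -map_trmx fAX.
pose g := 'X^(size s) - rVpoly c.
have size_g : size g = (size s).+1.
  by rewrite size_polyDl size_polyXn // size_polyN ltnS size_poly.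
have monic_g : lead_coef g = 1.
  by rewrite lead_coefDl ?lead_coefXn // size_polyN size_polyXn ltnS size_poly.
(* Coordinate [j] of the relation in the eigenbasis is the value of [g] at the eigenvalue times
   [w j 0], which is nonzero. *)
have root_g z : z \in s -> root (map_poly f g) z.
  move=> /support_seqP[j wj ->]; apply/eqP/(mulIf wj); rewrite mul0r.
  have vec_j i : (P *m map_mx f (A ^+ i *m v)) j 0 = d 0 j ^+ i * w j 0.
    by rewrite fAX diag_mx_expr_vec.
  have -> : map_poly f g = 'X^(size s) - rVpoly (map_mx f c).
    by rewrite rmorphB /= map_polyXn map_rVpoly.
  rewrite hornerD hornerN hornerXn mulrBl -vec_j -[A ^+ _ *m v]trmxK vB.
  rewrite mulmx_sum_row linear_sum map_mx_sum mulmx_sumr summxE.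
  rewrite (@horner_coef_wide _ (size s)) ?size_poly // mulr_suml.
  apply/eqP; rewrite subr_eq0; apply/eqP/eq_bigr => i _.
  rewrite coef_rVpoly_ord -mulrA -vec_j rowK linearZ /= trmxK map_mxZ -scalemxAr mxE.
  by rewrite [map_mx f c 0 i]mxE.
(* [g] is monic of degree [size s] and vanishes on the distinct elements of [s], hence splits over
   them. *)
exists g; have := @all_roots_prod_XsubC _ (map_poly f g) s.
rewrite size_map_poly size_g lead_coef_map monic_g rmorph1 scale1r; apply => //.
  exact/allP.
by rewrite uniq_rootsE undup_uniq.
Qed.

(** * Rationality and integrality of eigenvalues *)

(** A root of the monic integral characteristic polynomial is an algebraic integer, and a rational
    algebraic integer is an integer. *)
Lemma rat_eigenvalue_int (n : nat) (Z : 'M[int]_n) (r : rat) :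
  eigenvalue (map_mx intr Z) r -> exists m : int, r = m%:~R.
Proof.
rewrite eigenvalue_root_char -map_char_poly => root_r.
have alg_root : root (map_poly intr (char_poly Z)) (ratr r : algC).
  rewrite -[map_poly _ _](_ : map_poly ratr (map_poly intr (char_poly Z)) = _).
    by rewrite fmorph_root.
  by rewrite -map_poly_comp; apply: eq_map_poly => m /=; rewrite rmorph_int.
have /intrP[m rm] : (ratr r : algC) \is a Num.int.
  apply: Cint_rat_Aint; first exact: Crat_rat.
  apply: root_monic_Aint alg_root _ _.
    by apply: monic_map; apply: char_poly_monic.
  by apply/polyOverP => i; rewrite coef_map /= intr_int.
by exists m; apply: (fmorph_inj (ratr : {rmorphism rat -> algC})); rewrite rmorph_int.
Qed.

(* The sum of the roots is rational by Vieta, and it is a positive integer multiple of c unless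
   all the roots vanish; so c itself is rational. *)
Lemma roots_multiples_rat (K : numFieldType) (g : {poly rat}) (s : seq K) (c : K) :
  map_poly ratr g = \prod_(z <- s) ('X - z%:P) ->
  (forall z, z \in s -> exists m : nat, z = m%:R * c) ->
  forall z, z \in s -> exists r : rat, z = ratr r.
Proof.
move=> g_roots s_mult z0 z0s.
have sum_rat : exists q : rat, \sum_(z <- s) z = ratr q.
  exists (- g`_(size s).-1); rewrite rmorphN -coef_map g_roots.
  rewrite coefPn_prod_XsubC ?opprK //.
  by case: (s) z0s.
have [M sumM M0] : exists2 M : nat, \sum_(z <- s) z = M%:R * c &
    (M = 0%N -> forall z, z \in s -> z = 0).
  elim: (s) s_mult => [|z s' IH] mult; first by exists 0%N; rewrite // big_nil mul0r.
  have [|M sumM M0] := IH; first by move=> y ys; apply: mult; rewrite inE ys orbT.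
  have [|m zm] := mult z; first exact: mem_head.
  exists (m + M)%N; first by rewrite big_cons sumM zm natrD mulrDl.
  move=> /eqP; rewrite addn_eq0 => /andP[/eqP m0 /eqP /M0 s'0] y.
  by rewrite inE => /predU1P[->|/s'0 //]; rewrite zm m0 mul0r.
have [M_eq0|M_neq0] := eqVneq M 0%N.
  by exists 0; rewrite rmorph0; apply: M0.
have [q sumq] := sum_rat; have [m ->] := s_mult _ z0s.
exists (m%:R * (q / M%:R)); rewrite !rmorphM /= fmorphV !rmorph_nat -sumq sumM.
by rewrite [M%:R * c]mulrC mulfK // pnatr_eq0.
Qed.

(** * The Laplacian matrix and its spectrum *)

Lemma sum_adj (K : pzRingType) (G : sgraph) (x : G) :
  \sum_(i < #|G|) (adj x (enum_val i))%:R = (valency x)%:R :> K.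
Proof.
rewrite /valency -[X in _ = X%:R]sum1_card natr_sum [RHS]big_mkcond /=.
rewrite (reindex (@enum_rank G)) /=; last exact/onW_bij/enum_rank_bij.
by apply: eq_bigr => y _; rewrite enum_rankK inE; case: (adj x y).
Qed.

Lemma laplacianE (K : pzRingType) (G : sgraph) (i j : 'I_#|G|) :
  laplacian K G i j =
  (valency (enum_val i))%:R *+ (i == j) - (adj (enum_val i) (enum_val j))%:R.
Proof. by rewrite !mxE. Qed.

Lemma map_laplacian (K K' : pzRingType) (f : {rmorphism K -> K'}) (G : sgraph) :
  map_mx f (laplacian K G) = laplacian K' G.
Proof.
by apply/matrixP => i j; rewrite mxE !laplacianE rmorphB rmorphMn !rmorph_nat.
Qed.

Lemma laplacian_tr (K : pzRingType) (G : sgraph) : (laplacian K G)^T = laplacian K G.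
Proof.
apply/matrixP => i j; rewrite mxE !laplacianE adj_sym eq_sym.
by case: eqVneq => [->|].
Qed.

Lemma laplacian_row_sum (K : pzRingType) (G : sgraph) :
  (const_mx 1 : 'rV[K]_#|G|) *m laplacian K G = 0.
Proof.
apply/rowP => j; rewrite !mxE.
under eq_bigr => i _ do rewrite laplacianE mxE mul1r adj_sym.
rewrite sumrB sum_adj (bigD1 j) //= eqxx big1 ?addr0 ?subrr // => i.
by move=> /negPf->.
Qed.

Lemma valency_le (G : sgraph) (x : G) : (valency x <= max_valency G)%N.
Proof. exact: (leq_bigmax x). Qed.

(* Gershgorin's disc at the largest coordinate of an eigenvector. *)
Lemma laplacian_eigenvalue_itv (R : realFieldType) (G : sgraph) (t : R) :
  eigenvalue (laplacian R G) t -> 0 <= t <= (2 * max_valency G)%:R.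
Proof.
move=> /eigenvalueP[v vL v_neq0].
have [i0 vi0] : exists i0, v 0 i0 != 0.
  by apply/existsP; apply: contraNT v_neq0 => /existsPn v0; apply/eqP/rowP => i;
     rewrite mxE; apply/eqP/negPn/v0.
pose j := [arg max_(i > i0) `|v 0 i|]%O.
have v_max i : `|v 0 i| <= `|v 0 j|.
  by rewrite /j; case: arg_maxP => // k _; apply.
have vj_gt0 : 0 < `|v 0 j| by apply: lt_le_trans (v_max i0); rewrite normr_gt0.
pose dj : R := (valency (enum_val j))%:R.
have disc : `|dj - t| <= dj.
  rewrite -(ler_pM2r vj_gt0) -normrM.
  have -> : (dj - t) * v 0 j = \sum_i v 0 i * (adj (enum_val j) (enum_val i))%:R.
    have /rowP/(_ j) := vL; rewrite mxE [RHS]mxE mulrBl => <-.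
    under eq_bigr => i _ do rewrite laplacianE mulrBr adj_sym.
    rewrite sumrB (bigD1 j) //= eqxx big1 => [|i /negPf->]; last by rewrite mulr0.
    by rewrite addr0 mulrC opprB addrC subrK.
  apply: le_trans (ler_norm_sum _ _ _) _; rewrite /dj -(sum_adj R) mulr_suml.
  apply: ler_sum => i _; rewrite normrM normr_nat mulrC.
  by apply: ler_wpM2l.
have dj_le : dj <= (max_valency G)%:R by rewrite ler_nat valency_le.
by move: disc; rewrite ler_distl natrM; lra.
Qed.

(** * From periodicity to an annihilating polynomial *)

Lemma laplacian_periodic_annihilator (R : realType) (G : sgraph) (a : G) :
  laplacian_periodic R a ->
  exists p : {poly R[i]}, [/\ p \is monic, (size p <= (2 * max_valency G).+2)%N &
    horner_vec (laplacian R[i] G) (vertex_vec R[i] a) p = 0].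
Proof.
move=> [tau [tau_gt0 [alpha per]]].
have [P P_unit [t L_diag]] := symmetric_diagonalizable (laplacian_tr R G).
move: L_diag; rewrite map_laplacian; set d := map_mx _ t => L_diag.
(* These are the eigenvalues exp(i tau t_j) of U(tau). *)
pose e : 'rV[R[i]]_#|G| := \row_j ((cos (tau * t 0 j))%:C + 'i * (sin (tau * t 0 j))%:C).
have U_diag : transition_mx G tau = invmx P *m diag_mx e *m P.
  rewrite /transition_mx L_diag.
  have -> : ('i * tau%:C) *: (invmx P *m diag_mx d *m P) =
      invmx P *m diag_mx (('i * tau%:C) *: d) *m P.
    by rewrite linearZ /= -scalemxAr -scalemxAl.
  apply: mxexp_conj_diag => // j.
  have -> : (('i * tau%:C) *: d) 0 j = 'i * (tau * t 0 j)%:C.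
    by rewrite !mxE rmorphM mulrA.
  by rewrite mxE; apply: cvg_exp_i.
pose w := P *m vertex_vec R[i] a.
have phase j : w j 0 != 0 -> e 0 j = alpha.
  move=> wj; apply: (mulIf wj).
  have := congr1 (fun u : 'cV_#|G| => (P *m u) j 0) per.
  rewrite /= U_diag !mulmxA mulmxV // mul1mx -mulmxA mul_diag_mx mxE => ->.
  by rewrite -scalemxAr mxE.
(* The row [q] can be nonzero only where [d] vanishes, and there [e] is 1; so U(tau) preserves
   coordinate sums, and that of e_a is 1. *)
have alpha1 : alpha = 1.
  pose one : 'rV[R[i]]_#|G| := const_mx 1.
  pose q := one *m invmx P.
  have one_a : one *m vertex_vec R[i] a = 1%:M.
    apply/matrixP => i j; rewrite !ord1 !mxE (bigD1 (enum_rank a)) //= big1.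
      by rewrite !mxE !eqxx mulr1 addr0.
    by move=> x /negPf xa; rewrite !mxE xa mulr0.
  have q_diag : q *m diag_mx d = 0.
    have := laplacian_row_sum R[i] G; rewrite L_diag !mulmxA => qdP.
    by rewrite -[LHS](mulmxK P_unit) qdP mul0mx.
  have q_fix : q *m diag_mx e = q.
    apply/rowP => j; rewrite mul_mx_diag mxE.
    have /rowP/(_ j) := q_diag; rewrite mul_mx_diag mxE [RHS]mxE => /eqP.
    rewrite mulf_eq0 => /orP[/eqP->|].
      by rewrite mul0r.
    rewrite !mxE => /eqP/complexI ->.
    by rewrite mulr0 cos0 sin0 rmorph0 mulr0 addr0 mulr1.
  have := congr1 (mulmx one) per.
  rewrite U_diag -scalemxAr one_a !mulmxA -/q q_fix mulmxKV // one_a => /matrixP/(_ 0 0).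
  by rewrite !mxE eqxx mulr1 => <-.
(* Row [j] of [P] is a left eigenvector, nonzero since [P] is invertible. *)
have eig j : eigenvalue (laplacian R G) (t 0 j).
  rewrite -(eigenvalue_map (real_complex R)) map_laplacian.
  apply/eigenvalueP; exists (row j P); last first.
    apply/eqP => rowj0; have : row j (P *m invmx P) = 0 by rewrite row_mul rowj0 mul0mx.
    by rewrite mulmxV // => /rowP/(_ j); rewrite !mxE eqxx => /eqP; rewrite oner_eq0.
  rewrite -row_mul L_diag !mulmxA mulmxV // mul1mx.
  by apply/rowP => l; rewrite mxE mul_diag_mx !mxE.
pose s := support_seq d w.
(* The real part of the phase equation is cos (tau t_j) = 1; nonnegativity of [t 0 j] makes the
   multiple a natural number. *)
have t_mult j : w j 0 != 0 -> exists m : nat, t 0 j = m%:R * (pi *+ 2 / tau).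
  move=> /phase; rewrite alpha1 mxE => /(congr1 (@complex.Re R)).
  rewrite /= !mul0r !mul1r subr0 addr0 => cos1.
  have /andP[t_ge0 _] := laplacian_eigenvalue_itv (eig j).
  have [|m tm] := cos_eq1 _ cos1; first by rewrite mulr_ge0 // ltW.
  exists m; rewrite mulrA -tm mulrAC divff ?mul1r //; exact: lt0r_neq0.
have [g g_roots] : exists g : {poly rat}, map_poly ratr g = support_poly d w.
  have := @support_poly_descent _ _ (ratr : {rmorphism rat -> R[i]}) _
    (laplacian rat G) (vertex_vec rat a) P d P_unit.
  by rewrite map_laplacian => /(_ L_diag); rewrite map_delta_mx.
have s_rat := roots_multiples_rat g_roots.
(* The list 0, ..., 2 [max_valency G] has 2 [max_valency G] + 1 members, and the size of a product
   of linear factors exceeds their number by one; hence the bound with [.+2]. *)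
have s_nat z : z \in s -> z \in [seq m%:R | m <- iota 0 (2 * max_valency G).+1].
  move=> zs; have [|r zr] := s_rat (pi *+ 2 / tau)%:C _ z zs.
    move=> y /support_seqP[j wj ->]; have [m tm] := t_mult j wj; exists m.
    by rewrite mxE tm rmorphM rmorph_nat.
  have /support_seqP[j _ zj] := zs.
  have [m rm] : exists m : int, r = m%:~R.
    apply: (@rat_eigenvalue_int _ (laplacian int G)).
    rewrite map_laplacian -(eigenvalue_map (ratr : {rmorphism rat -> R[i]})).
    rewrite map_laplacian /= -zr zj mxE -(map_laplacian (real_complex R)).
    by rewrite eigenvalue_map.
  have tm : t 0 j = m%:~R.
    apply: (@complexI R); rewrite rmorph_int -(ratr_int _ m) -rm -zr zj.
    by rewrite mxE.
  have := laplacian_eigenvalue_itv (eig j); rewrite tm.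
  rewrite ler0z pmulrn ler_int zr rm rmorph_int.
  case: m {rm tm} => // m /andP[_ m_le]; apply/mapP; exists m => //.
  by rewrite mem_iota add0n ltnS.
exists (support_poly d w); split; first exact: monic_prod_XsubC.
  rewrite size_prod_XsubC ltnS.
  have := uniq_leq_size (undup_uniq _) s_nat.
  by rewrite size_map size_iota.
by rewrite L_diag; apply: support_poly_vec.
Qed.

(** * Balls and powers of the Laplacian *)

(** Allowing [x == y] makes the balls increase with the radius; a sphere is then a ball minus all
    smaller ones. *)
Fixpoint graph_ball (G : sgraph) (a : G) (r : nat) : pred G :=
  if r is r'.+1 then
    fun y => [exists x, graph_ball a r' x && ((x == y) || adj x y)]
  else pred1 a.

Lemma graph_ballS (G : sgraph) (a x y : G) (r : nat) :
  graph_ball a r x -> (x == y) || adj x y -> graph_ball a r.+1 y.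
Proof. by move=> xr xy; apply/existsP; exists x; apply/andP. Qed.

Lemma graph_ball_le (G : sgraph) (a x : G) (r r' : nat) :
  (r <= r')%N -> graph_ball a r x -> graph_ball a r' x.
Proof.
move=> /subnK <-; elim: (r' - r)%N => [//|n IH] /IH xr.
by rewrite addSn; apply: graph_ballS xr _; rewrite eqxx.
Qed.

(** Each vertex of a ball accounts for itself and its neighbours, at most [(max_valency G).+1]
    vertices of the next ball. *)
Lemma card_graph_ball (G : sgraph) (a : G) (r : nat) :
  (#|graph_ball a r| <= (max_valency G).+1 ^ r)%N.
Proof.
elim: r => [|r IH]; first by rewrite card1.
rewrite expnSr; apply: leq_trans (leq_mul IH (leqnn _)).
rewrite -sum1_card -[X in (_ <= X * _)%N]sum1_card big_distrl /=.
apply: (@leq_trans (\sum_(x | graph_ball a r x) \sum_(y : G) ((x == y) || adj x y))%N).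
  rewrite exchange_big [X in (X <= _)%N]big_mkcond; apply: leq_sum => y _.
  case: ifP => // /existsP[x /andP[xr xy]].
  by rewrite (bigD1 x) //= xy.
apply: leq_sum => x _; rewrite mul1n.
rewrite (bigD1 x) //= eqxx add1n ltnS.
apply: leq_trans (valency_le x); rewrite /valency -sum1_card.
rewrite [X in (_ <= X)%N]big_mkcond [X in (X <= _)%N]big_mkcond.
apply: leq_sum => y _; rewrite inE eq_sym.
by case: eqVneq => //= _; case: (adj x y).
Qed.

Definition laplacian_pow_entry (K : pzRingType) (G : sgraph) (a : G) (r : nat) (y : G) : K :=
  (laplacian K G ^+ r *m vertex_vec K a) (enum_rank y) 0.

Lemma laplacian_pow_entry0 (K : pzRingType) (G : sgraph) (a y : G) :
  laplacian_pow_entry K a 0 y = (y == a)%:R.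
Proof.
by rewrite /laplacian_pow_entry expr0 mul1mx mxE (inj_eq enum_rank_inj) eqxx andbT.
Qed.

Lemma laplacian_pow_entryS (K : pzRingType) (G : sgraph) (a y : G) (r : nat) :
  laplacian_pow_entry K a r.+1 y = (valency y)%:R * laplacian_pow_entry K a r y -
    \sum_x (adj y x)%:R * laplacian_pow_entry K a r x.
Proof.
rewrite /laplacian_pow_entry exprS -[_ * _]/(_ *m _) -mulmxA mxE.
under eq_bigr => j _ do rewrite laplacianE enum_rankK mulrBl.
rewrite sumrB (bigD1 (enum_rank y)) //= eqxx big1 ?addr0; last first.
  by move=> j; rewrite eq_sym => /negPf->; rewrite mul0r.
congr (_ - _); rewrite (reindex (@enum_rank G)) /=; last exact/onW_bij/enum_rank_bij.
by apply: eq_bigr => x _; rewrite enum_rankK.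
Qed.

(* On the sphere of radius r only the walks of adjacency steps contribute to the r-th power,
   so all contributions have the sign (-1)^r. *)
Lemma laplacian_pow_entry_sphere (K : numDomainType) (G : sgraph) (a y : G) (r : nat) :
  (forall i, (i < r)%N -> ~~ graph_ball a i y) ->
  (graph_ball a r y -> 0 < (-1) ^+ r * laplacian_pow_entry K a r y) /\
  (~~ graph_ball a r y -> laplacian_pow_entry K a r y = 0).
Proof.
elim: r y => [|r IH] y out.
  by rewrite laplacian_pow_entry0 mul1r /=; case: (y == a).
have entryE : (-1) ^+ r.+1 * laplacian_pow_entry K a r.+1 y =
    \sum_x (adj y x)%:R * ((-1) ^+ r * laplacian_pow_entry K a r x).
  have [_ entry0] := IH y (fun i ir => out i (ltnW ir)).
  rewrite laplacian_pow_entryS entry0 ?out // mulr0 sub0r exprS mulN1r mulrNN mulr_sumr.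
  by apply: eq_bigr => x _; rewrite mulrCA.
(* A neighbour of [y] is at most one step closer to [a], so the induction hypothesis applies to
   it. *)
have nbr_out x : adj y x -> forall i, (i < r)%N -> ~~ graph_ball a i x.
  move=> yx i ir; apply: contra (out i.+1 ir) => xi.
  by apply: graph_ballS xi _; rewrite adj_sym yx orbT.
have term_ge0 x : 0 <= (adj y x)%:R * ((-1) ^+ r * laplacian_pow_entry K a r x).
  case yx: (adj y x); last by rewrite mul0r.
  have [pos zero] := IH x (nbr_out x yx); rewrite mul1r.
  by have [/pos/ltW|/zero->] := boolP (graph_ball a r x); rewrite ?mulr0.
split=> [/existsP[x /andP[xr /orP[/eqP xy|xy]]] | y_out].
- by have /negP[] := out r (ltnSn r); rewrite -xy.
- rewrite entryE (bigD1 x) //= ltr_wpDr ?sumr_ge0 // adj_sym xy mul1r.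
  by have [pos _] := IH x (nbr_out x (etrans (adj_sym y x) xy)); apply: pos.
have : (-1) ^+ r.+1 * laplacian_pow_entry K a r.+1 y = 0.
  rewrite entryE big1 // => x _; case yx: (adj y x); last by rewrite mul0r.
  have [_ ->] := IH x (nbr_out x yx); first by rewrite !mulr0.
  by apply: contra y_out => xr; apply: graph_ballS xr _; rewrite adj_sym yx orbT.
by move/eqP; rewrite mulf_eq0 signr_eq0 => /eqP.
Qed.

(** At a vertex whose distance from [a] is exactly the degree of [p], only the leading term
    survives, and it is nonzero. So that sphere is empty, and by connectedness the ball of radius
    one less is the whole graph. *)
Lemma card_le_annihilator (K : numDomainType) (G : sgraph) (a : G) (p : {poly K}) (n : nat) :
  connected_graph G -> p \is monic -> (size p <= n.+2)%N ->
  horner_vec (laplacian K G) (vertex_vec K a) p = 0 ->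
  (#|G| <= (max_valency G).+1 ^ n)%N.
Proof.
move=> conn p_monic p_size p_ann.
have [d size_p] : exists d, size p = d.+1.
  by exists (size p).-1; rewrite prednK // size_poly_gt0 monic_neq0.
have no_sphere y : graph_ball a d y -> ~ (forall i, (i < d)%N -> ~~ graph_ball a i y).
  move=> yd out; have [/(_ yd)] := @laplacian_pow_entry_sphere K G a y d out.
  suff -> : laplacian_pow_entry K a d y = 0 by rewrite mulr0 ltxx.
  have /colP/(_ (enum_rank y)) := p_ann.
  rewrite /horner_vec size_p big_ord_recr /= [RHS]mxE [LHS]mxE.
  have -> : p`_d = 1 by move/monicP: p_monic; rewrite lead_coefE size_p.
  rewrite scale1r summxE big1 ?add0r // => i _.
  rewrite mxE -/(laplacian_pow_entry K a i y).
  have [|_ zero] := @laplacian_pow_entry_sphere K G a y i.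
    by move=> j ji; apply: out; apply: ltn_trans (ltn_ord i).
  by rewrite zero ?mulr0 ?out.
(* Degree 0 is impossible, since [a] itself is at distance 0. From here on the degree is [d.+1]. *)
case: d => [|d] in size_p no_sphere *.
  by case: (no_sphere a) => //=.
(* An edge leaving the ball of radius [d] would end at distance exactly [d.+1]. *)
have ball_closed x y : connect (@adj G) x y -> graph_ball a d x -> graph_ball a d y.
  move=> /connectP[s + ->]; elim: s x => [//|z s IH] x /= /andP[xz zs] xd.
  apply: IH zs _; apply: contraT => z_out; case: (no_sphere z).
    by apply: graph_ballS xd _; rewrite xz orbT.
  by move=> i; rewrite ltnS => id; apply: contra z_out; apply: graph_ball_le.
have ballT y : graph_ball a d y.
  by apply: (ball_closed a) => //; apply: (@graph_ball_le _ _ _ 0) => //=.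
apply: (@leq_trans ((max_valency G).+1 ^ d)%N).
  have -> : #|G| = #|graph_ball a d| by apply: eq_card => y; apply/esym; exact: ballT.
  exact: card_graph_ball.
(* Here [size p] is [d.+2], so [d <= n]. *)
by rewrite leq_pexp2l // -ltnS -ltnS -size_p.
Qed.

(** * Finiteness up to isomorphism *)

(** Symmetrizing [E] and discarding the diagonal turns every boolean function into a graph, so the
    codes form a finite type with no side condition. *)
Definition graph_of_ffun (n : nat) (E : {ffun 'I_n * 'I_n -> bool}) : sgraph.
Proof.
refine (@SGraph 'I_n (fun x y => (x != y) && (E (x, y) || E (y, x))) _ _).
  by move=> x y; rewrite eq_sym orbC.
by move=> x; rewrite eqxx.
Defined.

Lemma finitely_many_bounded_card (P : sgraph -> Prop) (n : nat) :
  (forall G, P G -> #|G| <= n)%N -> finitely_many_up_to_iso P.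
Proof.
move=> P_le; pose T : finType := {m : 'I_n.+1 & {ffun 'I_m * 'I_m -> bool}}.
exists #|T|, (fun i => graph_of_ffun (tagged (enum_val i : T))) => G /P_le.
rewrite -ltnS => G_lt; pose m := Ordinal G_lt.
pose E : {ffun 'I_m * 'I_m -> bool} := [ffun p => adj (enum_val p.1) (enum_val p.2)].
exists (enum_rank (Tagged (fun m : 'I_n.+1 => {ffun 'I_m * 'I_m -> bool}) E : T)).
rewrite enum_rankK /=; exists (@enum_rank G); split; first exact: enum_rank_bij.
move=> x y; rewrite /= !ffunE /= !enum_rankK (inj_eq enum_rank_inj) [adj y x]adj_sym orbb.
by case: eqVneq => [->|//]; rewrite adj_irrefl.
Qed.

Theorem theorem8p6 (R : realType) (k : int) :
  finitely_many_up_to_iso (fun G : sgraph =>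
    [/\ connected_graph G,
        (max_valency G)%:Z <= k &
        exists a : G, laplacian_periodic R a]).
Proof.
(* Degree at most 2k + 1 gives radius 2k. The absolute value turns [k] into a natural number; for
   negative [k] no graph qualifies. *)
apply: (@finitely_many_bounded_card _ (`|k|.+1 ^ (2 * `|k|))%N) => G [conn val_le [a per]].
have [p [p_monic p_size p_ann]] := laplacian_periodic_annihilator per.
apply: leq_trans (card_le_annihilator conn p_monic p_size p_ann) _.
have val_le' : (max_valency G <= `|k|)%N.
  by case: k val_le => // k; rewrite lez_nat.
apply: (@leq_trans (`|k|.+1 ^ (2 * max_valency G))%N).
  (* Comparing powers through their bases needs a positive exponent, hence the separate case of
     valency 0. *)
  by case: (posnP (2 * max_valency G)) => [->|?]; rewrite // leq_exp2r.
by rewrite leq_pexp2l // leq_mul2l.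
Qed.
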